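(* Let $A$ be a real $m\times n$ matrix and let $b\in\mathbb{R}^m$. The linear system of inequalities $Ax\ge b$ is feasible (that is, there exists $x\in\mathbb{R}^n$ with $Ax\ge b$) if and only if $$\min\{F(x,\Delta b) : x\in\mathbb{R}^n,\ \Delta b\in\mathbb{R}^m,\ Ax\ge b-\Delta b,\ \Delta b\ge 0\}=0,$$ where $F(x,\Delta b)=(c,\Delta b)$ and $c=(1,1,\dots,1)\in\mathbb{R}^m$.
   Context: Inequalities between vectors in $\mathbb{R}^m$ are understood coordinatewise. $(\cdot,\cdot)$ denotes the standard inner product on $\mathbb{R}^m$, so $F(x,\Delta b)$ is the sum of the coordinates of $\Delta b$. The symbol $\Delta b$ denotes a single vector variable in $\mathbb{R}^m$ (it is not a product). ''$\min = 0$'' means that the minimum value of $F$ over the stated set of pairs $(x,\Delta b)$ is attained and equals $0$. *)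

(* Defs.v *)
From mathcomp Require Import all_boot all_order all_algebra.
From mathcomp Require Import classical_sets reals.

Set Implicit Arguments.
Unset Strict Implicit.
Unset Printing Implicit Defensive.

Import Order.TTheory GRing.Theory Num.Theory.
Local Open Scope classical_set_scope.
Local Open Scope ring_scope.

Definition le_cv (R : realType) (m : nat) (u v : 'cV[R]_m) : Prop :=
  forall i : 'I_m, u i 0 <= v i 0.

Definition inner (R : realType) (m : nat) (u v : 'cV[R]_m) : R :=
  \sum_(i < m) u i 0 * v i 0.

Definition feasible (R : realType) (m n : nat) (A : 'M[R]_(m, n))
    (b : 'cV[R]_m) : Prop :=
  exists x : 'cV[R]_n, le_cv b (A *m x).

Definition relaxed_set (R : realType) (m n : nat) (A : 'M[R]_(m, n))
    (b : 'cV[R]_m) : set ('cV[R]_n * 'cV[R]_m) :=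
  [set p | le_cv (b - p.2) (A *m p.1) /\ le_cv 0 p.2].

Definition F (R : realType) (m n : nat) (p : 'cV[R]_n * 'cV[R]_m) : R :=
  inner (const_mx 1) p.2.

(* The minimum is attained: [l] belongs to [S], unlike with [inf S], which is
   moreover 0 by convention when [S] is empty or unbounded below. *)
Definition is_minimum (R : realType) (S : set R) (l : R) : Prop :=
  S l /\ lbound S l.

(* Main.v *)
Require Import Defs.
From mathcomp Require Import all_boot all_order all_algebra.
From mathcomp Require Import classical_sets reals.

(** A feasible point of the original system is a relaxed point with zero
    perturbation, and there [F] vanishes; since [F] is a sum of nonnegative
    coordinates on the relaxed set, 0 is then its minimum. Conversely, a
    nonnegative perturbation whose coordinates sum to 0 is itself 0
    ([F_eq0]), so a relaxed point at which the value 0 is attained solves the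
    original system. *)

Import Order.TTheory GRing.Theory Num.Theory.
Local Open Scope classical_set_scope.
Local Open Scope ring_scope.

Lemma FE (R : realType) (m n : nat) (p : 'cV[R]_n * 'cV[R]_m) :
  F p = \sum_(i < m) p.2 i 0.
Proof. by apply: eq_bigr => i _; rewrite mxE mul1r. Qed.

Lemma F_ge0 (R : realType) (m n : nat) (p : 'cV[R]_n * 'cV[R]_m) :
  le_cv 0 p.2 -> 0 <= F p.
Proof.
by move=> p_ge0; rewrite FE sumr_ge0// => i _; have := p_ge0 i; rewrite mxE.
Qed.

Lemma F_eq0 (R : realType) (m n : nat) (p : 'cV[R]_n * 'cV[R]_m) :
  le_cv 0 p.2 -> F p = 0 -> p.2 = 0.
Proof.
move=> p_ge0; rewrite FE => /psumr_eq0P p_eq0.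
apply/colP => i; rewrite mxE; apply: p_eq0 => // j _.
by have := p_ge0 j; rewrite mxE.
Qed.

Theorem mainTheorem1 (R : realType) (m n : nat) (A : 'M[R]_(m, n))
    (b : 'cV[R]_m) :
  feasible A b <-> is_minimum ((@F R m n) @` relaxed_set A b) 0.
Proof.
split=> [[x Ax_ge_b]|[[[x db] [Ax_ge db_ge0] F0] _]].
  split; last by move=> _ [p [_ p_ge0] <-]; exact: F_ge0.
  exists (x, 0); last by rewrite FE big1// => i _; rewrite mxE.
  by split=> //=; rewrite subr0.
by exists x; move: Ax_ge; rewrite (F_eq0 _ _ _ _ db_ge0 F0) subr0.
Qed.
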